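(* Let $r, t \ge 2$ be integers. There exists a measurable partition \[ C = \bigcup_{i=1}^r E_i \] of the circle $C=\mathbb{R}/\mathbb{Z}$ such that for every measurable cover of $C$ by $t$ sets, \[ C \subset F_1 \cup \cdots \cup F_t, \] there exist an index $m \in \{1,\dots,t\}$ and an element $\theta \in C$ such that \[ \mu_1\big(R_{\theta}(F_m) \cap E_i\big) > 0 \quad\text{for all } 1\le i\le r. \]
   Context: $C$ denotes the unit circle, identified with the compact abelian group $\mathbb{R}/\mathbb{Z}$, and $\mu_1$ is the normalized Haar measure on $C$, so $\mu_1(C)=1$. For $\theta\in C$, the rotation $R_\theta : C\to C$ is $R_\theta(x) := x+\theta \pmod 1$, and $R_\theta(F)$ denotes the image of $F\subset C$. A measurable partition is a decomposition into pairwise disjoint measurable sets; a measurable cover consists of measurable subsets $F_1,\dots,F_t$ of $C$, not necessarily disjoint. The partition $\{E_i\}$ may depend on $r$ and $t$ but not on the cover. *)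

(* Defs.v *)
From HB Require Import structures.
From mathcomp Require Import all_boot all_order all_algebra.
From mathcomp Require Import generic_quotient ring_quotient archimedean.
From mathcomp Require Import all_classical all_reals all_analysis measurable_realfun.

Set Implicit Arguments.
Unset Strict Implicit.
Unset Printing Implicit Defensive.

Import Order.TTheory GRing.Theory Num.Theory.
Import numFieldNormedType.Exports.

Local Open Scope classical_set_scope.
Local Open Scope ring_scope.

Definition int_subgroup (R : realType) : zmodClosed R :=
  GRing.ZmodClosed.clone R (@Num.int_num_subdef R) _.

(* R/Z, with the quotient group law, the quotient topology and the Borel
   sigma-algebra of that topology. *)
Definition circle (R : realType) : Type :=
  quotient_topology {ideal_quot (int_subgroup R)}.

HB.instance Definition _ (R : realType) := Topological.on (circle R).
HB.instance Definition _ (R : realType) := Pointed.on (circle R).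
HB.instance Definition _ (R : realType) :=
  GRing.Zmodule.copy (circle R) {ideal_quot (int_subgroup R)}.
HB.instance Definition _ (R : realType) :=
  @isMeasurable.Build (sigma_display (open : set (set (circle R)))) (circle R)
    <<s (open : set (set (circle R))) >>
    (@sigma_algebra0 _ setT _) (@sigma_algebraC _ _) (@sigma_algebra_bigcup _ setT _).

Definition to_circle (R : realType) (x : R) : circle R :=
  (\pi_({ideal_quot (int_subgroup R)}) x)%qT.

Definition rotation (R : realType) (theta x : circle R) : circle R := x + theta.

Section circle_facts.
Context {R : realType}.
Implicit Types (x y : R) (A : set (circle R)).

Lemma to_circleD x y : to_circle (x + y) = to_circle x + to_circle y.
Proof. exact: Quotient.pi_add. Qed.

Lemma to_circleN x : to_circle (- x) = - to_circle x.
Proof. exact: Quotient.pi_opp. Qed.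

Lemma to_circle_surj (z : circle R) : exists x : R, to_circle x = z.
Proof. by exists (repr (z : {ideal_quot (int_subgroup R)})); exact: reprK. Qed.

Lemma to_circle_eq x y :
  to_circle x = to_circle y <-> exists k : int, x - y = k%:~R.
Proof.
have xyE := Quotient.idealrBE (int_subgroup R) x y.
split=> [xy|[k xyk]].
  have /intrP[k xyk] : x - y \is a Num.int.
    by apply: (etrans xyE); exact/eqP.
  by exists k.
have /eqP : (x == y %[mod {ideal_quot (int_subgroup R)}])%qT; last exact.
by apply: (etrans (esym xyE)); rewrite xyk; exact: (intr_int R k).
Qed.

Lemma open_circleE A : open A = open (@to_circle R @^-1` A).
Proof. by []. Qed.

Lemma measurable_to_circle :
  measurable_fun setT (@to_circle R : measurableTypeR R -> circle R).
Proof.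
apply: (@measurability _ _ _ _ _ _ (open : set (set (circle R)))) => //.
move=> _ [A oA <-]; rewrite setTI.
exact: open_measurable.
Qed.

End circle_facts.

(* Normalized Haar measure: the image under R -> R/Z of Lebesgue measure on
   [0, 1[; see mu1_setT and mu1_rotation. *)
Definition mu1 (R : realType) : set (circle R) -> \bar R :=
  pushforward (mrestr (@lebesgue_measure R) (measurable_itv `[0%R, 1%R[))
    (@to_circle R : measurableTypeR R -> circle R).

Section mu1_facts.
Local Open Scope ereal_scope.
Context {R : realType}.
Implicit Types A : set (circle R).
Local Notation lambda := (@lebesgue_measure R).

Lemma mu1E A : mu1 A = lambda (@to_circle R @^-1` A `&` `[0%R, 1%R[).
Proof. by []. Qed.

Let mu1_0 : mu1 set0 = 0 :> \bar R.
Proof. by rewrite mu1E preimage_set0 set0I measure0. Qed.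

Let mu1_ge0 A : 0 <= mu1 A.
Proof. by rewrite mu1E measure_ge0. Qed.

Let mu1_sigma_additive : semi_sigma_additive (@mu1 R).
Proof.
apply: (@measure_semi_sigma_additive _ _ _ (pushforward
  (mrestr lambda (measurable_itv `[0%R, 1%R[))
  (@to_circle R : measurableTypeR R -> circle R))).
exact: measurable_to_circle.
Qed.

HB.instance Definition _ := isMeasure.Build _ _ _ (@mu1 R)
  mu1_0 mu1_ge0 mu1_sigma_additive.

Lemma mu1_setT : mu1 [set: circle R] = 1.
Proof.
by rewrite mu1E preimage_setT setTI lebesgue_measure_itv/= lte01 sube0.
Qed.

HB.instance Definition _ :=
  @Measure_isProbability.Build _ _ R (@mu1 R) mu1_setT.

Lemma measurable_shift (s : R) :
  measurable_fun setT
    ((fun x => x + s)%R : measurableTypeR R -> measurableTypeR R).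
Proof. exact: measurable_funD. Qed.

Lemma lebesgue_measure_shift (s : R) (B : set R) :
  measurable (B : set (measurableTypeR R)) ->
  lambda ((fun x => x + s)%R @^-1` B) = lambda B.
Proof.
move=> mB; pose f := (fun x => x + s)%R : measurableTypeR R -> measurableTypeR R.
have mf : measurable_fun setT f := measurable_shift s.
rewrite -[LHS]/(pushforward lambda f B).
apply/esym/lebesgue_measure_unique => //= _ [[a b]] _ <-.
rewrite /pushforward.
have -> : f @^-1` [set` `]a, b]%R] = [set` `](a - s), (b - s)]%R].
  by apply/seteqP; split => x /=; rewrite /f !in_itv/= ltrBlDr lerBrDr.
by rewrite !lebesgue_measure_itv/= !lte_fin ltrD2r -!EFinB opprB addrA subrK.
Qed.

Lemma mu1_rotation (theta : circle R) A : measurable A ->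
  mu1 (rotation theta @` A) = mu1 A.
Proof.
move=> mA; have [t0 t0E] := to_circle_surj theta.
pose t := (t0 - (Num.floor t0)%:~R)%R.
have tE : to_circle t = theta.
  rewrite -t0E; apply/to_circle_eq; exists (- Num.floor t0)%R.
  by rewrite /t mulrNz addrAC subrr add0r.
have /andP[t_ge0 t_lt1] : (0 <= t < 1)%R.
  rewrite /t subr_ge0 ltrBlDl; have := floor_itv t0.
  by rewrite intrD.
set B : set (measurableTypeR R) := @to_circle R @^-1` A.
have mB : measurable B.
  by rewrite -[B]setTI; exact: measurable_to_circle.
have B1 x : B (x - 1)%R = B x.
  rewrite /B /=; congr A; apply/to_circle_eq; exists (-1)%R.
  by rewrite addrAC subrr add0r.
rewrite !mu1E -/B.
have -> : @to_circle R @^-1` (rotation theta @` A) `&` `[0%R, 1%R[ =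
    (fun x => x - t)%R @^-1` (B `&` `[(- t)%R, (1 - t)%R[).
  apply/seteqP; split => x /=; rewrite !in_itv/= lerBrDr ltrBlDr addNr subrK.
    move=> [[z Az zx] ->]; split => //.
    rewrite /B /= to_circleD to_circleN tE -zx /rotation.
    by rewrite addrK.
  move=> [Bx ->]; split => //; exists (to_circle (x - t)) => //.
  by rewrite /rotation to_circleD to_circleN tE subrK.
rewrite lebesgue_measure_shift; last exact: measurableI.
have itvU (a b c : R) : (a <= b <= c)%R ->
    lambda (B `&` `[a, c[) = lambda (B `&` `[a, b[) + lambda (B `&` `[b, c[).
  move=> /andP[ab bc]; rewrite -measureU//; try exact: measurableI.
    rewrite -setIUr; congr (lambda (B `&` _)).
    by rewrite -(@itv_bndbnd_setU _ _ _ (BLeft b)).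
  apply/seteqP; split => // x /= [[_ +] [_ +]]; rewrite !in_itv/=.
  by move=> /andP[_ xb] /andP[bx _]; move: (lt_le_trans xb bx); rewrite ltxx.
rewrite (itvU (- t)%R 0%R (1 - t)%R); last by rewrite oppr_le0 t_ge0 subr_ge0 ltW.
rewrite (itvU 0%R (1 - t)%R 1%R); last by rewrite subr_ge0 gerBl t_ge0 ltW.
rewrite addeC; congr (_ + _).
rewrite -(lebesgue_measure_shift (- 1)); last exact: measurableI.
congr (lambda _); apply/seteqP; split => x /=; rewrite B1 !in_itv/=.
  by rewrite lerBrDr ltrBlDr add0r addrC.
by rewrite lerBrDr ltrBlDr add0r [in X in X -> _]addrC.
Qed.

End mu1_facts.

(* Main.v *)
(* Write a finite word over the r colours containing every word of length t as
   a factor, cut the circle into N arcs, N being the length of the word, and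
   give the n-th arc the n-th letter as colour.  If every rotate of every F_j
   essentially misses some colour, let p j be a colour missed by F_j rotated by
   j/N.  Where the factor p 0, ..., p (t-1) begins lies an arc A whose rotate by
   j/N has colour p j for all j, so A meets every F_j in a null set; as A has
   measure 1/N, the F_j do not cover it. *)
Require Import Defs.
From mathcomp Require Import all_boot all_order all_algebra.
From mathcomp Require Import all_classical all_reals all_analysis.
From mathcomp Require Import lra.

Import Order.TTheory GRing.Theory Num.Theory.
Import numFieldNormedType.Exports.

Local Open Scope classical_set_scope.

(** The concatenation of all words of length [t] works: every [p] is spelled out by its own
    block. *)
Lemma universal_word (T : finType) (t : nat) (x0 : T) :
  exists s : seq T, forall p : 'I_t -> T,
    exists n : nat, forall j : 'I_t, (n + j < size s)%N /\ nth x0 s (n + j) = p j.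
Proof.
exists (flatten [seq codom f | f : {ffun 'I_t -> T}]) => p.
have /path.splitPr : finfun p \in enum {ffun 'I_t -> T} by rewrite mem_enum.
rewrite /image_mem => -[s1 s2].
(* [u] concatenates the blocks preceding that of [p], so its length is where this block starts. *)
rewrite map_cat flatten_cat /=; set u := flatten (map _ s1).
exists (size u) => j; have jt : (j < size (codom (finfun p)))%N.
  by rewrite size_codom card_ord.
rewrite !size_cat ltn_add2l ltn_addr//; split=> //.
rewrite nth_cat ltnNge leq_addr /= addKn nth_cat jt.
by rewrite (nth_map j) ?size_enum_ord// nth_ord_enum ffunE.
Qed.

Local Open Scope ring_scope.

Section circle.
Context {R : realType}.
Implicit Types (theta : circle R) (A : set (circle R)).

Lemma open_measurable_circle A : open A -> measurable A.
Proof. by move=> oA; exact: sub_sigma_algebra. Qed.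

Lemma to_circle_periodic (x : R) (k : int) : to_circle (x + k%:~R) = to_circle x.
Proof. by apply/to_circle_eq; exists k; rewrite addrAC subrr add0r. Qed.

Lemma open_preimage_shift (U : set R) (s : R) :
  open U -> open ((fun x => x + s) @^-1` U).
Proof.
move=> oU; apply: open_comp => // x _.
by apply: cvgD; [exact: cvg_id|exact: cvg_cst].
Qed.

(** The saturation of [U] is the union of its integer translates, each of which is open. *)
Lemma open_to_circle (U : set R) : open U -> open (@to_circle R @` U).
Proof.
move=> oU; rewrite open_circleE.
have -> : @to_circle R @^-1` (@to_circle R @` U) =
    \bigcup_(k : int) ((fun x => x + k%:~R) @^-1` U).
  apply/seteqP; split=> x /=.
    move=> [y Uy /to_circle_eq[k yxk]]; exists k => //=.
    by rewrite -yxk addrC subrK.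
  by move=> [k _ /= Uxk]; exists (x + k%:~R) => //; exact: to_circle_periodic.
by apply: bigcup_open => k _; exact: open_preimage_shift.
Qed.

(** The image is the preimage under the inverse rotation, whose measurability is tested on open
    sets, where it amounts to continuity of a translation of the line. *)
Lemma measurable_rotation theta A :
  measurable A -> measurable (rotation theta @` A).
Proof.
move=> mA.
have mf : measurable_fun setT (rotation (- theta)).
  apply: (@measurability _ _ _ _ _ _ (open : set (set (circle R)))) => //.
  move=> _ [B oB <-]; rewrite setTI; apply: open_measurable_circle.
  have [s sE] := to_circle_surj (- theta).
  rewrite open_circleE.
  have -> : @to_circle R @^-1` (rotation (- theta) @^-1` B) =
      (fun x => x + s) @^-1` (@to_circle R @^-1` B).
    by apply/seteqP; split=> x /=; rewrite to_circleD sE.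
  exact: open_preimage_shift.
suff -> : rotation theta @` A = rotation (- theta) @^-1` A.
  by rewrite -[X in measurable X]setTI; exact: mf.
apply/seteqP; split=> x /=; rewrite /rotation.
  by move=> [z Az <-]; rewrite addrK.
by move=> Ax; exists (x - theta) => //; rewrite subrK.
Qed.

Lemma mu1_eq0_subset (A B : set (circle R)) : measurable A -> measurable B ->
  A `<=` B -> ~ (0 < mu1 B)%E -> mu1 A = 0%E.
Proof.
move=> mA mB AB /negP; rewrite -leNgt => B0; apply/eqP.
by rewrite -measure_le0; apply: le_trans B0; apply: le_measure; rewrite ?inE.
Qed.

Definition arc (N n : nat) : set (circle R) :=
  @to_circle R @` `]n%:R / N%:R, n.+1%:R / N%:R[%classic.

Lemma open_arc N n : open (arc N n).
Proof. by apply: open_to_circle; exact: interval_open. Qed.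

Lemma measurable_arc N n : measurable (arc N n).
Proof. by apply: open_measurable_circle; exact: open_arc. Qed.

Lemma mu1_arc_gt0 N n : (n < N)%N -> (0 < mu1 (arc N n))%E.
Proof.
move=> nN; have N0 : 0 < N%:R :> R by rewrite ltr0n (leq_ltn_trans _ nN).
rewrite mu1E; pose I : set R := `]n%:R / N%:R, n.+1%:R / N%:R[%classic.
(* Only positivity is wanted, so a lower bound is enough: the lift [I] has positive length and lies
   inside [[0, 1[] because [n < N]. *)
apply: (@lt_le_trans _ _ (lebesgue_measure I)).
  rewrite lebesgue_measure_itv /= lte_fin ltr_pM2r ?invr_gt0// ltr_nat ltnSn.
  by rewrite -EFinB lte_fin subr_gt0 ltr_pM2r ?invr_gt0// ltr_nat.
apply: le_measure; rewrite ?inE.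
- exact: measurable_itv.
- apply: measurableI; last exact: measurable_itv.
  rewrite -[X in measurable X]setTI; apply: measurable_to_circle => //.
  exact: measurable_arc.
- move=> x Ix; split; first by exists x.
  move: Ix; rewrite /I /= !in_itv /= => /andP[nx xn]; apply/andP; split.
    by apply: le_trans (ltW nx); rewrite divr_ge0.
  by apply: (lt_le_trans xn); rewrite ler_pdivrMr// mul1r ler_nat.
Qed.

(** Lifts of a common point differ by an integer, which must be 0 since both lie in the open unit
    interval; the common lift times [N] then lies in both []n, n + 1[] and []m, m + 1[]. *)
Lemma arc_disjoint N n m : (n < N)%N -> (m < N)%N ->
  arc N n `&` arc N m !=set0 -> n = m.
Proof.
move=> nN mN [_ [[x + <-] [y + /to_circle_eq[k yxk]]]].
have N0 : 0 < N%:R :> R by rewrite ltr0n (leq_ltn_trans _ nN).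
rewrite /= !in_itv /= !ltr_pdivrMr// !ltr_pdivlMr//.
move=> /andP[nx xn] /andP[my ym].
have n0 : 0 <= n%:R :> R by rewrite ler0n.
have m0 : 0 <= m%:R :> R by rewrite ler0n.
have nN1 : n.+1%:R <= N%:R :> R by rewrite ler_nat.
have mN1 : m.+1%:R <= N%:R :> R by rewrite ler_nat.
(* [x * N] and [y * N] lie strictly between 0 and [N], so [k] lies strictly between -1 and 1. *)
have k0 : k = 0.
  have kN : k%:~R * N%:R = y * N%:R - x * N%:R by rewrite -yxk mulrBl.
  have kl : k%:~R < 1 :> R by rewrite -(ltr_pM2r N0) kN; lra.
  have kg : -1 < k%:~R :> R by rewrite -(ltr_pM2r N0) kN; lra.
  move: kl kg; rewrite -[1]/(1%:~R) -mulrNz !ltr_int.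
  by case: k {yxk kN} => [[|k]|k].
have yx : y = x by apply/eqP; rewrite -subr_eq0 yxk k0.
subst y; apply/eqP; rewrite eqn_leq.
have nm : (n < m.+1)%N by rewrite -(ltr_nat R) (lt_trans nx ym).
have mn : (m < n.+1)%N by rewrite -(ltr_nat R) (lt_trans my xn).
by rewrite -ltnS nm -ltnS mn.
Qed.

Lemma rotation_arc N n j :
  rotation (to_circle (j%:R / N%:R : R)) @` arc N n `<=` arc N (n + j).
Proof.
move=> _ [_ [x + <-] <-]; rewrite /= !in_itv /= => /andP[nx xn].
exists (x + j%:R / N%:R); last by rewrite to_circleD.
by rewrite /= in_itv /= -addSn !natrD !mulrDl !ltrD2r nx.
Qed.

(* The end points of the arcs, which no open arc contains, get colour [c0]. *)
Definition coloured {r : nat} (c0 : 'I_r) (s : seq 'I_r) (i : 'I_r) :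
    set (circle R) :=
  let arcs k := \bigcup_(n in [set n | (n < size s)%N /\ nth c0 s n = k])
    arc (size s) n in
  if i == c0 then ~` \bigcup_(k in [set k | k != c0]) arcs k else arcs i.

Section coloured.
Context {r : nat} (c0 : 'I_r) (s : seq 'I_r).

Lemma measurable_coloured i : measurable (coloured c0 s i).
Proof.
have oarcs k : open (\bigcup_(n in [set n | (n < size s)%N /\ nth c0 s n = k])
    arc (size s) n : set (circle R)).
  by apply: bigcup_open => n _; exact: open_arc.
rewrite /coloured; case: ifP => _; [apply: measurableC|];
  apply: open_measurable_circle => //.
by apply: bigcup_open => k _; exact: oarcs.
Qed.

Lemma trivIset_coloured : trivIset [set: 'I_r] (coloured c0 s).
Proof.
move=> i j _ _ [x []]; rewrite /coloured.
case: (eqVneq i c0) => [->|ic]; case: (eqVneq j c0) => [->|jc] //.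
- by move=> nx xj; exfalso; apply: nx; exists j.
- by move=> xi nx; exfalso; apply: nx; exists i.
(* Neither colour is [c0]: a common point makes the two arcs the same, hence also their letters. *)
- move=> [n [ns <-] xn] [m [ms <-] xm].
  by congr nth; apply: (@arc_disjoint (size s)) => //; exists x.
Qed.

Lemma bigcup_coloured : \bigcup_i coloured c0 s i = [set: circle R].
Proof.
apply/seteqP; split=> // x _.
have [[i ic xi]|nx] := pselect (exists2 i, i != c0 & coloured c0 s i x).
  by exists i.
exists c0 => //; rewrite /coloured eqxx => -[k /= kc xk].
by apply: nx; exists k => //; rewrite /coloured (negbTE kc).
Qed.

Lemma arc_coloured n : (n < size s)%N ->
  arc (size s) n `<=` coloured c0 s (nth c0 s n).
Proof.
move=> ns x xn; rewrite /coloured; case: eqVneq => [nc|_]; last by exists n.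
(* The arc at [m] has a colour other than [c0], yet disjointness forces [m = n], whose letter is
   [c0]. *)
move=> [k /= kc [m [ms mk] xm]]; move/eqP: kc; apply.
by rewrite -mk -[RHS]nc; congr nth; apply: (@arc_disjoint (size s)) => //; exists x.
Qed.

End coloured.

End circle.

Local Open Scope ereal_scope.

Theorem theorem1p3 (R : realType) (r t : nat) (hr : (2 <= r)%N) (ht : (2 <= t)%N) :
  exists E : 'I_r -> set (circle R),
    (forall i, measurable (E i)) /\
    trivIset [set: 'I_r] E /\
    \bigcup_i E i = [set: circle R] /\
    (forall F : 'I_t -> set (circle R),
       (forall j, measurable (F j)) ->
       [set: circle R] `<=` \bigcup_j F j ->
       exists (m : 'I_t) (theta : circle R),
         forall i : 'I_r, 0 < mu1 ((rotation theta @` F m) `&` E i)).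
Proof.
pose c0 : 'I_r := Ordinal (ltnW hr).
have [s s_univ] := universal_word _ t c0.
exists (coloured c0 s); split; first exact: measurable_coloured.
split; first exact: trivIset_coloured.
split; first exact: bigcup_coloured.
move=> F mF coverF; apply: contrapT => noF.
pose theta (j : 'I_t) := to_circle (j%:R / (size s)%:R : R)%R.
have /choice[p pP] (j : 'I_t) : exists i, ~ 0 < mu1
    ((rotation (theta j) @` F j) `&` coloured c0 s i).
  by apply/existsNP => Fj; apply: noF; exists j, (theta j).
have [n nP] := s_univ p.
pose A : set (circle R) := arc (size s) n.
have mA : measurable A by exact: measurable_arc.
(* The rotation by [theta j] carries [F j] and [A] into a set that is null by the choice of [p j];
   invariance of [mu1] brings this back to the unrotated set. *)
have FA0 j : mu1 (F j `&` A) = 0.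
  have mFA : measurable (F j `&` A) by exact: measurableI.
  rewrite -(mu1_rotation (theta j))//.
  apply: (mu1_eq0_subset _ _ _ _ _ (pP j)).
  - exact: measurable_rotation.
  - by apply: measurableI; [exact: measurable_rotation|exact: measurable_coloured].
  - have [njs <-] := nP j.
    move=> _ [x [Fx Ax] <-]; split; first by exists x.
    by apply: arc_coloured => //; apply: rotation_arc; exists x.
(* The bound on [n] is read off from the letter of index 0, which exists because [t] is positive. *)
have ns : (n < size s)%N.
  by have [njs _] := nP (Ordinal (ltnW ht)); exact: leq_ltn_trans (leq_addr _ _) njs.
have := @mu1_arc_gt0 R _ _ ns; rewrite ltNge => /negP; apply.
(* Finite subadditivity bounds [mu1 A] by a sum of zeros, as the sets [F j] cover [A]. *)
apply: le_trans (@content_sub_fsum _ _ _ (@mu1 R) _ [set: 'I_t] A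
  (fun j => F j `&` A) _ _ mA _) _ => //.
- exact: finite_finset.
- by move=> j _; exact: measurableI.
- by move=> x Ax; have [j _ Fx] := coverF x I; exists j.
- by rewrite fsbig1 //= => j _; exact: FA0.
Qed.
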